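(* Define integers $b_{\mathcal{G}}(n)$, $n\ge0$, by $b_{\mathcal{G}}(0)=1$, $b_{\mathcal{G}}(1)=-1$, $b_{\mathcal{G}}(2)=-1$ and, for $n\ge3$, $$b_{\mathcal{G}}(n)=-\frac12\left(\sum_{k=0}^{n-2}b_{\mathcal{G}}(k)\binom{n}{k+1}+\sum_{k=0}^{n-1}b_{\mathcal{G}}(k)\binom{n+1}{k+1}\right).$$ Then $b_{\mathcal{G}}(2n)=b_{\mathcal{G}}(2n-1)$ for all $n\ge1$. *)

(* Defs.v *)
From mathcomp Require Import all_boot all_order all_algebra.
From mathcomp Require Import ring zify.
Set Implicit Arguments.
Unset Strict Implicit.
Unset Printing Implicit Defensive.
Import Order.TTheory GRing.Theory Num.Theory.
Local Open Scope ring_scope.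

(* The recurrence is an equality of rationals, so that the factor 1/2 is a
   genuine division. *)
Definition is_bG (b : nat -> int) : Prop :=
  [/\ b 0%N = 1, b 1%N = -1, b 2%N = -1
    & forall n : nat, (3 <= n)%N ->
        (b n)%:~R = - (1 / 2) *
          (\sum_(0 <= k < n.-1) b k * 'C(n, k.+1)%:Z
           + \sum_(0 <= k < n) b k * 'C(n.+1, k.+1)%:Z)%:~R :> rat].

Lemma is_bG_uniq (b b' : nat -> int) : is_bG b -> is_bG b' -> b =1 b'.
Proof.
move=> [b0 b1 b2 bS] [b0' b1' b2' bS'] n.
elim/ltn_ind: n => -[_|[_|[_|n IH]]]; rewrite ?b0 ?b1 ?b2 //.
apply: (@intr_inj rat); rewrite bS // bS' //; congr (_ * (_ + _)%:~R).
  by apply: eq_big_nat => k /andP[_ kn]; rewrite IH //; apply: ltn_trans kn _.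
by apply: eq_big_nat => k /andP[_ kn]; rewrite IH.
Qed.

(* Existence of an integer solution (integrality of the recurrence). Let L be
   the linear form on int[X] with L('X^n) = G_n (Genocchi numbers), given on
   falling factorials by L(X(X-1)...(X-j)) = (-1)^j sum_(k <= j) k! (j-k)!.
   It satisfies L(p(X) + p(X+1)) = 2 p'(0), and b(n) = - L(X^(n+2) (X+1)). *)
Module Existence.

Definition a (j : nat) : nat := (\sum_(k < j) k`! * (j.-1 - k)`!)%N.

Lemma aS j : (2 * a j.+1 = j.+1 * a j + 2 * j`!)%N.
Proof.
case: j => [|j]; first by rewrite /a big_ord1 big_ord0.
have e1 : a j.+2 = (\sum_(k < j.+1) k`! * (j.+1 - k)`! + j.+1`!)%N.
  by rewrite /a big_ord_recr /= subnn muln1.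
have e2 : a j.+2 = (j.+1`! + \sum_(k < j.+1) k.+1`! * (j - k)`!)%N.
  by rewrite /a big_ord_recl /= mul1n subn0.
have e3 : (j.+2 * a j.+1 = \sum_(k < j.+1) k`! * (j.+1 - k)`!
                          + \sum_(k < j.+1) k.+1`! * (j - k)`!)%N.
  rewrite /a big_distrr -big_split /=; apply: eq_bigr => k _.
  have kj := ltn_ord k; rewrite subSn // !factS.
  by have -> : j.+2 = ((j - k).+1 + k.+1)%N by [lia]; ring.
by rewrite e3; lia.
Qed.

Definition lam (j : nat) : int := (-1) ^+ j.+1 * (a j)%:Z.

Definition step (f : nat -> int) (j : nat) : int := f j.+1 + j%:Z * f j.
Definition M (n : nat) : nat -> int := iter n step lam.

Definition L (p : {poly int}) : int := \sum_(i < size p) p`_i * M i 0%N.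

Lemma LE N (p : {poly int}) : (size p <= N)%N -> L p = \sum_(i < N) p`_i * M i 0%N.
Proof.
move=> pN; rewrite /L (big_ord_widen _ (fun i => p`_i * M i 0%N) pN) big_mkcond.
by apply: eq_bigr => i _; case: ltnP => // ip; rewrite nth_default // mul0r.
Qed.

Lemma LD p q : L (p + q) = L p + L q.
Proof.
set N := maxn (size p) (size q).
rewrite (LE (size_polyD p q)) (@LE N p) ?leq_maxl // (@LE N q) ?leq_maxr //.
by rewrite -big_split; apply: eq_bigr => i _; rewrite coefD mulrDl.
Qed.

Lemma LZ c p : L (c *: p) = c * L p.
Proof.
rewrite (LE (size_scale_leq c p)) /L big_distrr /=.
by apply: eq_bigr => i _; rewrite coefZ mulrA.
Qed.

Lemma LXn n : L 'X^n = M n 0%N.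
Proof.
rewrite /L size_polyXn big_ord_recr /= big1 ?coefXn ?eqxx ?mul1r ?add0r //.
by move=> i _; rewrite coefXn (ltn_eqF (ltn_ord i)) mul0r.
Qed.

Definition ff (j : nat) : {poly int} := \prod_(i < j) ('X - (i%:Z)%:P).

Lemma ffS j : ff j.+1 = ff j * 'X - j%:Z *: ff j.
Proof. by rewrite /ff big_ord_recr /= mulrBr [X in _ - X]mulrC mul_polyC. Qed.

Lemma LM n j : L ('X^n * ff j) = M n j.
Proof.
elim: j n => [|j IH] n; first by rewrite /ff big_ord0 mulr1 LXn.
have e : 'X^n * ff j.+1 = 'X^(n.+1) * ff j + (- j%:Z) *: ('X^n * ff j) :> {poly int}.
  by rewrite ffS exprS -!mul_polyC rmorphN /=; ring.
by rewrite e LD LZ !IH /M /= /step; ring.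
Qed.

Definition sh (p : {poly int}) := p \Po ('X + 1).

Lemma ff_coef1 j : (ff j.+1)`_1 = (-1) ^+ j * (j`!)%:Z.
Proof.
have f0 i : (ff i.+1)`_0 = 0.
  by elim: i => [|i IH]; rewrite ffS coefB coefMX coefZ /= ?IH ?mulr0 ?mul0r subr0.
elim: j => [|j IH]; first by rewrite /ff big_ord1 coefB coefX coefC.
by rewrite ffS coefB coefMX coefZ /= f0 IH factS PoszM exprS; ring.
Qed.

Lemma sh_ffS j : sh (ff j.+1) = ('X + 1) * ff j.
Proof.
elim: j => [|j IH].
  by rewrite /sh /ff big_ord1 big_ord0 comp_polyB comp_polyX comp_polyC subr0 mulr1.
rewrite {1}/ff big_ord_recr /= -/(ff j.+1) /sh comp_polyM -/(sh _) IH.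
rewrite comp_polyB comp_polyX comp_polyC ffS -mul_polyC.
by rewrite -addn1 PoszD polyCD; ring.
Qed.

Lemma keyM n j : L ('X^n * ff j) + L (sh ('X^n * ff j)) = 2 * ('X^n * ff j)`_1.
Proof.
elim: n j => [|n IH] j.
  rewrite mul1r; case: j => [|j].
    rewrite /ff big_ord0 /sh comp_polyC coef1 /=.
    by rewrite -(expr0 'X) LXn /M /= /lam /a big_ord0.
  have -> : sh (ff j.+1) = ff j.+1 + j.+1%:Z *: ff j.
    by rewrite sh_ffS ffS -!mul_polyC -addn1 PoszD polyCD; ring.
  rewrite LD LZ -[ff j.+1]mul1r -[ff j]mul1r -(expr0 'X) !LM /M /=.
  rewrite expr0 mul1r ff_coef1 /lam; have := aS j; rewrite !exprS.
  move=> /(congr1 Posz); rewrite [RHS]PoszD !PoszM => e.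
  by transitivity ((-1) ^+ j * (2%:Z * (a j.+1) - j.+1%:Z * a j)); [ring | rewrite e; ring].
have e : 'X^(n.+1) * ff j = 'X^n * ff j.+1 + j%:Z *: ('X^n * ff j) :> {poly int}.
  by rewrite ffS exprS -!mul_polyC; ring.
have := IH j; have := IH j.+1; rewrite e /sh comp_polyD comp_polyZ !LD !LZ coefD coefZ.
by move=> *; lia.
Qed.

Lemma key p : L p + L (sh p) = 2 * p`_1.
Proof.
have keyX n c : L (c *: 'X^n) + L (sh (c *: 'X^n)) = 2 * (c *: 'X^n)`_1.
  have := keyM n 0; rewrite /ff big_ord0 mulr1 /sh comp_polyZ !LZ coefZ => e.
  by rewrite -mulrDr e; ring.
rewrite -[p]coefK poly_def.
elim/big_ind: _ => [|q r eq er|i _]; last exact: keyX.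
  by rewrite /sh comp_poly0 /L size_poly0 !big_ord0 coef0.
by rewrite /sh comp_polyD !LD coefD mulrDr -eq -er /sh; ring.
Qed.

Definition K p := - L (p * ('X * ('X + 1))).
Definition bb n := K 'X^(n.+1).

Lemma Ksum n : K (('X + 1) ^+ n) = \sum_(0 <= k < n) bb k * 'C(n, k.+1)%:Z.
Proof.
have K0 : K 1 = 0.
  rewrite /K mul1r; have -> : 'X * ('X + 1) = 'X^2 + 'X^1 :> {poly int} by ring.
  rewrite LD !LXn /M /= /step /lam /a !big_ord_recl !big_ord0 /=.
  by rewrite /bump /=.
have KD p q : K (p + q) = K p + K q by rewrite /K mulrDl LD opprD.
have KZ c p : K (c *: p) = c * K p by rewrite /K -scalerAl LZ mulrN.
rewrite addrC exprDn big_ord_recl big_mkord.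
rewrite KD expr1n bin0 mulr1n expr0 mulr1 K0 add0r.
elim/big_ind2: _ => [|p x q y <- <-|i _] //.
  by rewrite /K mul0r /L size_poly0 big_ord0 oppr0.
rewrite expr1n mul1r /bb mulrC -KZ; congr K.
by rewrite -natz scaler_nat.
Qed.

Lemma bbP n : 2 * bb n.+1 + (\sum_(0 <= k < n) bb k * 'C(n.+1, k.+1)%:Z
           + \sum_(0 <= k < n.+1) bb k * 'C(n.+2, k.+1)%:Z) = 0.
Proof.
have e1 := Ksum n.+1; have e2 := Ksum n.+2.
rewrite big_nat_recr //= binn mulr1 in e1.
rewrite big_nat_recr //= binn mulr1 in e2.
set q : {poly int} := 'X^(n.+2) * ('X + 1) * ('X - 1).
have e : K (('X + 1) ^+ n.+2) + K (('X + 1) ^+ n.+1) + bb n.+1 - bb n = - (L q + L (sh q)).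
  have -> : sh q = ('X + 1) ^+ n.+2 * ('X * ('X + 1)) + ('X + 1) ^+ n.+1 * ('X * ('X + 1)).
    rewrite /sh /q 2!comp_polyM comp_polyB comp_polyD comp_Xn_poly comp_polyX comp_polyC.
    by rewrite !exprS; ring.
  have -> : q = 'X^(n.+2) * ('X * ('X + 1)) + (-1) *: ('X^(n.+1) * ('X * ('X + 1))).
    by rewrite /q scaleN1r !exprS; ring.
  by rewrite !LD LZ /bb /K; ring.
have q1 : q`_1 = 0 by rewrite /q -mulrA coefXnM.
by move: e; rewrite key q1 e1 e2 mulr0 oppr0 => e; rewrite -[RHS]e; ring.
Qed.

End Existence.

Lemma is_bG_exists : exists b : nat -> int, is_bG b.
Proof.
exists Existence.bb; have P := Existence.bbP.
have b0 : Existence.bb 0 = 1.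
  rewrite /Existence.bb /Existence.K.
  have -> : 'X^1 * ('X * ('X + 1)) = 'X^3 + 'X^2 :> {poly int} by ring.
  rewrite Existence.LD !Existence.LXn /Existence.M /= /Existence.step.
  by rewrite /Existence.lam /Existence.a !big_ord_recl !big_ord0.
have b1 : Existence.bb 1 = -1.
  by have := P 0%N; rewrite big_geq // big_nat1 b0 bin1; lia.
have b2 : Existence.bb 2 = -1.
  by have := P 1%N; rewrite !big_nat_recr //= !big_geq // b0 b1 !bin1 (_ : 'C(3, 2) = 3%N) //; lia.
split=> // -[//|n] _; set T := (X in _ * X%:~R).
have e : 2 * Existence.bb n.+1 + T = 0 by exact: P.
have -> : T = - (2 * Existence.bb n.+1) by apply/eqP; rewrite -addr_eq0 addrC e.
by move: (Existence.bb _) => x; rewrite intrN intrM; field.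
Qed.

(* Main.v *)
Require Import Defs.
From HB Require Import structures.
From mathcomp Require Import all_boot all_order all_algebra.
From mathcomp Require Import ring.

Set Implicit Arguments.
Unset Strict Implicit.
Unset Printing Implicit Defensive.

Import GRing.Theory Num.Theory.
Local Open Scope ring_scope.

(** Let [K] be the linear form on polynomials with [K 1 = 0] and
    [K 'X^(k+1) = b k], and put [u n = 'X^(n+2) - 'X^(n+1)].  The reflection
    [X |-> -1 - X] sends [u n] to [(-1)^n ((X + 1)^(n+2) + (X + 1)^(n+1))], so
    the recurrence reads [K (u n (-1 - X)) = - (-1)^n K (u n)].  In particular
    [K (p(-1 - X)) = - K p] for one [p] of each even degree: [p = 1] and
    [p = u n] with [n] even.  In odd degree this holds for
    [p = 'X^n - (-1 - X)^n], which the reflection maps to [- p].  As these [p]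
    include one of each degree, linearity gives it for all [p], and then
    for odd [n] the recurrence gives [2 K (u n) = 0], where
    [K (u n) = b (n + 1) - b n]. *)

Lemma size_polyD_eq (R : nzSemiRingType) (p q : {poly R}) :
    size q = size p -> lead_coef p + lead_coef q != 0 ->
  size (p + q) = size p.
Proof.
move=> size_q; rewrite !lead_coefE size_q -coefD => lead_neq0.
apply/eqP; rewrite eqn_leq (leq_trans (size_polyD p q)) ?size_q ?maxnn //=.
rewrite leqNgt; apply: contraNN lead_neq0 => size_lt.
by rewrite nth_default // -ltnS (ltn_predK size_lt).
Qed.

Lemma scalar_poly_eq0 (R : idomainType) (f : {scalar {poly R}}) :
    (forall n, exists2 p : {poly R}, size p = n.+1 & f p = 0) ->
  forall p, f p = 0.
Proof.
move=> basis p; move: {-1}(size p) (leqnn (size p)) => n.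
elim: n p => [|n IH] p size_p.
  by move: size_p; rewrite size_poly_leq0 => /eqP ->; rewrite linear0.
have [q size_q fq0] := basis n.
have q_lead : q`_n != 0.
  by have := lead_coef_eq0 q; rewrite lead_coefE -size_poly_eq0 size_q => ->.
pose r := q`_n *: p - p`_n *: q.
have /IH : (size r <= n)%N.
  apply/leq_sizeP => i; rewrite coefB !coefZ leq_eqVlt.
  case/predU1P => [<-|lt_ni]; first by rewrite mulrC subrr.
  rewrite [p`_i]nth_default ?[q`_i]nth_default ?size_q ?(leq_trans size_p) //.
  by rewrite !mulr0 subrr.
rewrite linearB /= !scalarZ fq0 mulr0 subr0 => /eqP.
by rewrite mulf_eq0 (negPf q_lead) => /eqP.
Qed.

Section Reflection.

Variables (R : comNzRingType) (c : R).

Definition reflect_poly (p : {poly R}) : {poly R} := p \Po (c%:P - 'X).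

HB.instance Definition _ :=
  GRing.Linear.copy reflect_poly (comp_poly (c%:P - 'X)).

Lemma reflect_polyK : involutive reflect_poly.
Proof.
move=> p; rewrite /reflect_poly -comp_polyA comp_polyB comp_polyC comp_polyX.
by rewrite subKr comp_polyXr.
Qed.

End Reflection.

Lemma reflect_poly_subXn (R : comNzRingType) n :
  reflect_poly (-1) ('X^(n.+2) - 'X^(n.+1) : {poly R})
  = (-1) ^+ n *: (('X + 1) ^+ n.+2 + ('X + 1) ^+ n.+1).
Proof.
have -> : reflect_poly (-1) = comp_poly (- ('X + 1)) :> ({poly R} -> {poly R}).
  by rewrite /reflect_poly polyCN opprD addrC.
rewrite comp_polyB !comp_Xn_poly ![(- ('X + 1)) ^+ _]exprNn !exprS -mul_polyC.
by rewrite rmorph_sign; ring.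
Qed.

Section ReflectionAntisymmetry.

Variables (R : idomainType) (c : R).

Lemma size_reflect_poly (p : {poly R}) : size (reflect_poly c p) = size p.
Proof. by rewrite size_comp_poly2 // -opprB size_polyN size_XsubC. Qed.

Lemma lead_coef_reflect_poly (p : {poly R}) :
  lead_coef (reflect_poly c p) = lead_coef p * (-1) ^+ (size p).-1.
Proof.
rewrite lead_coef_comp -opprB ?size_polyN ?size_XsubC //.
by rewrite lead_coefN lead_coefXsubC.
Qed.

Hypothesis two_neq0 : 2 != 0 :> R.

Lemma size_sub_reflect_poly (p : {poly R}) :
  odd (size p).-1 -> size (p - reflect_poly c p) = size p.
Proof.
have [->|p_neq0 odd_p] := eqVneq p 0; first by rewrite size_poly0.
apply: size_polyD_eq; first by rewrite size_polyN size_reflect_poly.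
rewrite lead_coefN lead_coef_reflect_poly -signr_odd odd_p mulrN1 opprK.
by rewrite -mulr2n -mulr_natl mulf_neq0 ?lead_coef_eq0.
Qed.

Lemma scalar_reflect_polyN (K : {scalar {poly R}}) :
    (forall n, ~~ odd n ->
       exists2 u : {poly R}, size u = n.+1 & K (reflect_poly c u) = - K u) ->
  forall p, K (reflect_poly c p) = - K p.
Proof.
move=> even_antisym p; apply/eqP; rewrite -addr_eq0 addrC; apply/eqP.
pose S : {scalar {poly R}} := K \+ (K \o reflect_poly c).
rewrite -[LHS]/(S p); apply: scalar_poly_eq0 => n.
have [n_odd|/even_antisym[u size_u Ku]] := boolP (odd n); last first.
  by exists u; rewrite // /S /= Ku subrr.
exists ('X^n - reflect_poly c 'X^n).
  by rewrite size_sub_reflect_poly size_polyXn.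
rewrite /S /= [reflect_poly c (_ - _)]linearB /= reflect_polyK !linearB.
by ring.
Qed.

End ReflectionAntisymmetry.

Definition binomial_transform (V : nmodType) (a : nat -> V) (n : nat) : V :=
  \sum_(k < n.+1) a k *+ 'C(n, k).

Section UmbralEvaluation.

Variables (R : nzRingType) (a : nat -> R).

Definition umbral_eval (p : {poly R}) : R := \sum_(i < size p) p`_i * a i.

Lemma umbral_eval_widen n (p : {poly R}) :
  (size p <= n)%N -> umbral_eval p = \sum_(i < n) p`_i * a i.
Proof.
move=> size_p.
rewrite /umbral_eval (big_ord_widen _ (fun i => p`_i * a i) size_p) big_mkcond.
apply: eq_bigr => i _.
by case: ltnP => // /(nth_default 0) ->; rewrite mul0r.
Qed.

Lemma umbral_eval_is_scalar : scalar umbral_eval.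
Proof.
move=> k p q; pose n := maxn (size p) (size q).
have size_p : (size p <= n)%N by rewrite leq_maxl.
have size_q : (size q <= n)%N by rewrite leq_maxr.
have size_kp : (size (k *: p) <= n)%N := leq_trans (size_scale_leq k p) size_p.
have size_sum : (size (k *: p + q)%R <= n)%N.
  by rewrite (leq_trans (size_polyD _ _)) // geq_max size_kp.
rewrite (umbral_eval_widen size_sum) (umbral_eval_widen size_p).
rewrite (umbral_eval_widen size_q) mulr_sumr -big_split.
by apply: eq_bigr => i _; rewrite coefD coefZ mulrDl mulrA.
Qed.

HB.instance Definition _ :=
  GRing.isLinear.Build R {poly R} R *%R umbral_eval umbral_eval_is_scalar.

Lemma umbral_evalXn n : umbral_eval 'X^n = a n.
Proof.
rewrite /umbral_eval size_polyXn big_ord_recr /= coefXn eqxx mul1r.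
rewrite big1 ?add0r // => i _.
by rewrite coefXn ltn_eqF // mul0r.
Qed.

Lemma umbral_eval_exprXD1n n :
  umbral_eval (('X + 1) ^+ n) = binomial_transform a n.
Proof.
rewrite exprD1n linear_sum; apply: eq_bigr => k _.
by rewrite linearMn /= umbral_evalXn.
Qed.

End UmbralEvaluation.

Definition binomial_recurrence (V : zmodType) (a : nat -> V) : Prop :=
  forall n, a n.+2 - a n.+1
            + (binomial_transform a n.+2 + binomial_transform a n.+1) = 0.

Lemma binomial_recurrence_odd (R : idomainType) (a : nat -> R) :
    2 != 0 :> R -> a 0 = 0 -> binomial_recurrence a ->
  forall n, odd n -> a n.+2 = a n.+1.
Proof.
move=> two_neq0 a0 rec_a n n_odd.
pose K : {scalar {poly R}} := umbral_eval a.
pose u m : {poly R} := 'X^(m.+2) - 'X^(m.+1).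
have KuE m : K (u m) = a m.+2 - a m.+1 by rewrite linearB /= !umbral_evalXn.
have K_reflect_u m : K (reflect_poly (-1) (u m)) = - ((-1) ^+ m * K (u m)).
  rewrite reflect_poly_subXn scalarZ linearD /= !umbral_eval_exprXD1n KuE.
  by rewrite -mulrN; congr (_ * _); apply/eqP; rewrite -addr_eq0 addrC rec_a.
have K_antisym p : K (reflect_poly (-1) p) = - K p.
  apply: scalar_reflect_polyN p => // -[_|[//|m] /=].
    exists 1; first by rewrite size_poly1.
    by rewrite /reflect_poly comp_polyC -(expr0 'X) /= umbral_evalXn a0 oppr0.
  rewrite negbK => /negPf m_even; exists (u m).
    by rewrite size_polyDl ?size_polyN ?size_polyXn.
  by rewrite K_reflect_u -signr_odd m_even mul1r.
have /eqP := K_antisym (u n).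
rewrite K_reflect_u -signr_odd n_odd mulN1r opprK -addr_eq0 -mulr2n -mulr_natl.
by rewrite mulf_eq0 (negPf two_neq0) KuE subr_eq0 => /eqP.
Qed.

Definition prepend0 (V : nmodType) (b : nat -> V) (n : nat) : V :=
  if n is k.+1 then b k else 0.

Lemma binomial_transform_prepend0 (b : nat -> int) n :
  binomial_transform (prepend0 b) n = \sum_(0 <= k < n) b k * 'C(n, k.+1)%:Z.
Proof.
rewrite /binomial_transform big_ord_recl mul0rn add0r big_mkord.
by apply: eq_bigr => k _; rewrite -mulrzz.
Qed.

Lemma is_bG_recurrence (b : nat -> int) : is_bG b -> forall n,
  2 * b n.+1 + (\sum_(0 <= k < n) b k * 'C(n.+1, k.+1)%:Z
                + \sum_(0 <= k < n.+1) b k * 'C(n.+2, k.+1)%:Z) = 0.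
Proof.
move=> [b0 b1 b2 bS] [|[|n]].
- by rewrite big_geq // big_nat1 b0 b1.
- by rewrite big_nat1 !big_nat_recr //= big_geq // b0 b1 b2.
- by apply: (@intr_inj rat); rewrite intrD intrM bS //=; field.
Qed.

Lemma is_bG_binomial_recurrence (b : nat -> int) :
  is_bG b -> binomial_recurrence (prepend0 b).
Proof.
move=> hb n; rewrite -(is_bG_recurrence hb n) !binomial_transform_prepend0 /=.
rewrite [\sum_(0 <= k < n.+2) _]big_nat_recr //.
rewrite [X in _ + (_ + X) = _]big_nat_recr // !binn /=; ring.
Qed.

Theorem mainTheorem20 (b : nat -> int) (hb : is_bG b) (n : nat)
  (hn : (1 <= n)%N) : b (2 * n)%N = b (2 * n - 1)%N.
Proof.
case: n hn => // m _; rewrite mulnS add2n subn1 /=.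
have odd_2m1 : odd (2 * m).+1 by rewrite /= oddM.
have two_neq0 : 2 != 0 :> int by [].
have rec_b := is_bG_binomial_recurrence hb.
exact: (binomial_recurrence_odd two_neq0 (erefl 0) rec_b odd_2m1).
Qed.
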